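(* Let $\Gamma$ be the Cartan grading on the Albert algebra $\mathcal{A}$ over an algebraically closed field $\mathbb{F}$ of characteristic different from $2$. Identify $\mathrm{Supp}\,\Gamma\setminus\{0\}$ with the set of short roots in the root system $\Phi$ of type $F_4$ defined in the context. Then $W(\Gamma)=\mathrm{Aut}\,\Phi$.
   Context: Gradings and Weyl groups. For a grading $\Gamma:\mathcal{A}=\bigoplus_{g\in G}\mathcal{A}_g$ of a (nonassociative) algebra by an abelian group $G$ ($\mathcal{A}_g\mathcal{A}_h\subset\mathcal{A}_{g+h}$, additive notation), $\mathrm{Supp}\,\Gamma=\{g:\mathcal{A}_g\neq0\}$; $\mathrm{Aut}(\Gamma)$ is the group of algebra automorphisms of $\mathcal{A}$ permuting the nonzero components $\mathcal{A}_g$; $\mathrm{Stab}(\Gamma)$ is the subgroup of those leaving each component invariant; the Weyl group is $W(\Gamma)=\mathrm{Aut}(\Gamma)/\mathrm{Stab}(\Gamma)$. When $G$ is the universal abelian group of $\Gamma$ (i.e., for any realization of the same decomposition as a grading by an abelian group $H$ there is a unique homomorphism $G\to H$ restricting to the identity on the support), each $\varphi\in\mathrm{Aut}(\Gamma)$ induces a unique automorphism $u$ of $G$ with $\varphi(\mathcal{A}_s)=\mathcal{A}_{u(s)}$ for all $s\in\mathrm{Supp}\,\Gamma$, and in this way $W(\Gamma)$ is regarded as a subgroup of $\mathrm{Aut}(G)$. Cayley algebra. $\mathcal{C}$ is the $8$-dimensional algebra over $\mathbb{F}$ with basis $\{e_1,e_2,u_1,u_2,u_3,v_1,v_2,v_3\}$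 and multiplication, indices of $u,v$ taken modulo $3$: $e_1^2=e_1$, $e_2^2=e_2$, $e_1e_2=e_2e_1=0$; $e_1u_i=u_i=u_ie_2$, $e_2v_i=v_i=v_ie_1$, $e_2u_i=u_ie_1=e_1v_i=v_ie_2=0$; $u_iv_i=-e_1$, $v_iu_i=-e_2$, $u_iv_j=v_iu_j=0$ for $i\ne j$; $u_i^2=v_i^2=0$; $u_iu_{i+1}=-u_{i+1}u_i=v_{i+2}$, $v_iv_{i+1}=-v_{i+1}v_i=u_{i+2}$. Its norm $n$ is the multiplicative quadratic form with polar form $n(x,y)=n(x+y)-n(x)-n(y)$, where all basis elements are isotropic, $n(e_1,e_2)=n(u_i,v_i)=1$, and all other pairs of distinct basis elements are orthogonal; $\bar x=n(x,1)1-x$. Albert algebra. $\mathcal{A}$ is the algebra of Hermitian $3\times3$ matrices $\begin{pmatrix}\alpha_1&\bar a_3&a_2\\ a_3&\alpha_2&\bar a_1\\ \bar a_2&a_1&\alpha_3\end{pmatrix}$ ($\alpha_i\in\mathbb{F}$, $a_i\in\mathcal{C}$) with product $XY=\frac12(X\cdot Y+Y\cdot X)$, where $X\cdot Y$ is the usual matrix product. $E_i$ denotes the matrix with $\alpha_i=1$ and all other parameters $0$; $\iota_i(a)$ denotes the matrix with $a_i=2a$ and all other parameters $0$. So $\mathcal{A}=\bigoplus_{i=1}^3(\mathbb{F}E_i\oplus\iota_i(\mathcal{C}))$, the $E_i$ are orthogonal idempotents with sum $1$, and (indices modulo 3) $E_i\iota_i(a)=0$, $E_{i+1}\iota_i(a)=\frac12\iota_i(a)=E_{i+2}\iota_i(a)$,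 $\iota_i(a)\iota_{i+1}(b)=\iota_{i+2}(\bar a\bar b)$, $\iota_i(a)\iota_i(b)=2n(a,b)(E_{i+1}+E_{i+2})$. Cartan grading. In $\mathbb{Z}^4$ let $a_1=(1,0,0,0)$, $a_2=(0,1,0,0)$, $a_3=(-1,-1,0,0)$, $g_1=(0,0,1,0)$, $g_2=(0,0,0,1)$, $g_3=(0,0,-1,-1)$. The Cartan grading $\Gamma$ is the $\mathbb{Z}^4$-grading on $\mathcal{A}$ given, for $i=1,2,3$ (indices modulo 3), by $\deg E_i=0$; $\deg\iota_i(e_1)=a_i=-\deg\iota_i(e_2)$; $\deg\iota_i(u_i)=g_i=-\deg\iota_i(v_i)$; $\deg\iota_i(u_{i+1})=a_{i+2}+g_{i+1}=-\deg\iota_i(v_{i+1})$; $\deg\iota_i(u_{i+2})=-a_{i+1}+g_{i+2}=-\deg\iota_i(v_{i+2})$. Its universal abelian group is $\mathbb{Z}^4$, viewed inside $E=\mathbb{R}^4$; $\mathrm{Aut}(\mathbb{Z}^4)$ is viewed as a subgroup of $GL(E)$, so $W(\Gamma)$ is regarded as a subgroup of $GL(E)$. Root system. Let $\mathrm{Supp}\,\iota_1(\mathcal{C})$ be the set of degrees of nonzero homogeneous elements of $\iota_1(\mathcal{C})$. Put $\Phi=\bigl(\mathrm{Supp}\,\Gamma\cup\{\alpha+\beta:\alpha,\beta\in\mathrm{Supp}\,\iota_1(\mathcal{C}),\ \alpha\ne\pm\beta\}\bigr)\setminus\{0\}$, which is a root system of type $F_4$ in $E$, and $\mathrm{Aut}\,\Phi=\{\mu\in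 GL(E):\mu(\Phi)=\Phi\}$. *)

(* Defs.v *)
From HB Require Import structures.
From mathcomp Require Import all_boot all_order all_algebra.
From mathcomp Require Import classical_sets reals.
Set Implicit Arguments.
Unset Strict Implicit.
Unset Printing Implicit Defensive.
Import Order.TTheory GRing.Theory Num.Theory.

Local Open Scope classical_set_scope.
Local Open Scope ring_scope.

(* Indices 1, 2, 3 (modulo 3) of the usual notation are 0, 1, 2 : 'I_3 here;
   addition in 'I_3 is addition modulo 3. *)

Definition GL (F : fieldType) (V : vectType F) : set 'End(V) :=
  [set f | lker f == 0%VS].

Section Gradings.
Variables (F : fieldType) (A : vectType F) (mul : A -> A -> A).

Definition alg_aut : set 'End(A) :=
  [set f | GL f /\ forall x y, f (mul x y) = mul (f x) (f y)].

(* A grading is given by its family of homogeneous components. *)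
Variables (G : zmodType) (Gam : G -> {vspace A}).

Definition supp : set G := [set g | Gam g != 0%VS].

Definition grading_aut : set 'End(A) :=
  [set f | alg_aut f /\
     [set (f @: Gam g)%VS | g in supp] = [set Gam g | g in supp]].

Definition grading_stab : set 'End(A) :=
  [set f | grading_aut f /\ forall g, (f @: Gam g)%VS = Gam g].

(* The quotient Aut(Gam) / Stab(Gam), as the set of cosets. *)
Definition weyl_group : set (set 'End(A)) :=
  [set C | exists2 f, grading_aut f &
     C = [set (f \o h)%VF | h in grading_stab]].

Definition weyl_induces (C : set 'End(A)) (u : {additive G -> G}) : Prop :=
  bijective u /\
  forall f, C f -> forall s, supp s -> (f @: Gam s)%VS = Gam (u s).

End Gradings.

Inductive cayley_index := Ce1 | Ce2 | Cu of 'I_3 | Cv of 'I_3.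

Definition cayley_index_code (b : cayley_index) : bool + (bool * 'I_3) :=
  match b with
  | Ce1 => inl true | Ce2 => inl false
  | Cu i => inr (true, i) | Cv i => inr (false, i)
  end.
Definition cayley_index_decode (c : bool + (bool * 'I_3)) : cayley_index :=
  match c with
  | inl true => Ce1 | inl false => Ce2
  | inr (true, i) => Cu i | inr (false, i) => Cv i
  end.
Lemma cayley_index_codeK : cancel cayley_index_code cayley_index_decode.
Proof. by case. Qed.
HB.instance Definition _ := Finite.copy cayley_index (can_type cayley_index_codeK).

Definition cayley (F : fieldType) : vectType F := {ffun cayley_index -> F^o}.

Section Cayley.
Variable F : fieldType.
Local Notation C := (cayley F).

Definition cbase (b : cayley_index) : C := [ffun c => (c == b)%:R].

Definition cmul_base (b c : cayley_index) : C :=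
  match b, c with
  | Ce1, Ce1 => cbase Ce1
  | Ce1, Ce2 => 0
  | Ce1, Cu i => cbase (Cu i)
  | Ce1, Cv _ => 0
  | Ce2, Ce1 => 0
  | Ce2, Ce2 => cbase Ce2
  | Ce2, Cu _ => 0
  | Ce2, Cv i => cbase (Cv i)
  | Cu _, Ce1 => 0
  | Cu i, Ce2 => cbase (Cu i)
  | Cv i, Ce1 => cbase (Cv i)
  | Cv _, Ce2 => 0
  | Cu i, Cv j => if i == j then - cbase Ce1 else 0
  | Cv i, Cu j => if i == j then - cbase Ce2 else 0
  | Cu i, Cu j => if j == i + 1 then cbase (Cv (i + 2))
                  else if i == j + 1 then - cbase (Cv (j + 2)) else 0
  | Cv i, Cv j => if j == i + 1 then cbase (Cu (i + 2))
                  else if i == j + 1 then - cbase (Cu (j + 2)) else 0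
  end.

Definition cmul (x y : C) : C :=
  \sum_b \sum_c (x b * y c) *: cmul_base b c.

Definition cone : C := cbase Ce1 + cbase Ce2.

Definition cnorm (x : C) : F :=
  x Ce1 * x Ce2 + \sum_(i < 3) x (Cu i) * x (Cv i).

Definition cpolar (x y : C) : F := cnorm (x + y) - cnorm x - cnorm y.

Definition cconj (x : C) : C := cpolar x cone *: cone - x.

End Cayley.

(* An element of the Albert algebra is given by its parameters
   ((alpha_1, alpha_2, alpha_3), (a_1, a_2, a_3)). *)
Definition albert (F : fieldType) : vectType F :=
  ({ffun 'I_3 -> F^o} * {ffun 'I_3 -> cayley F})%type.

Section Albert.
Variable F : fieldType.
Local Notation C := (cayley F).
Local Notation A := (albert F).

Definition hermitian_mx (X : A) : 'M[C]_3 :=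
  let al i : C := X.1 i *: cone F in
  let a i : C := X.2 i in
  let a' i : C := cconj (X.2 i) in
  \matrix_(i, j) nth 0 (nth [::]
    [:: [:: al 0 ; a' 2 ; a 1  ];
        [:: a 2  ; al 1 ; a' 0 ];
        [:: a' 1 ; a 0  ; al 2 ]] i) j.

(* The parameters of a matrix of the above form: alpha_i is the coefficient of
   e_1 in M_ii, and a_1 = M_32, a_2 = M_13, a_3 = M_21. *)
Definition hermitian_param (M : 'M[C]_3) : A :=
  ([ffun i => M i i Ce1], [ffun i => M (i + 2) (i + 1)]).

Lemma hermitian_mxK : cancel hermitian_mx hermitian_param.
Proof.
have I3P (P : 'I_3 -> Prop) : P 0 -> P 1 -> P 2 -> forall i, P i.
  move=> h0 h1 h2 [[|[|[|//]]] Hi].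
  - by rewrite (_ : Ordinal Hi = 0) //; apply/val_inj.
  - by rewrite (_ : Ordinal Hi = 1) //; apply/val_inj.
  - by rewrite (_ : Ordinal Hi = 2) //; apply/val_inj.
case=> al a; rewrite /hermitian_param; congr (_, _); apply/ffunP; elim/I3P;
  by rewrite !ffunE mxE //= !ffunE /= addr0; apply: mulr1.
Qed.

Definition cmulmx (X Y : 'M[C]_3) : 'M[C]_3 :=
  \matrix_(i, j) \sum_k cmul (X i k) (Y k j).

Definition jordan_mx (X Y : 'M[C]_3) : 'M[C]_3 :=
  \matrix_(i, j) ((2%:R : F)^-1 *: (cmulmx X Y i j + cmulmx Y X i j)).

Definition amul (X Y : A) : A :=
  hermitian_param (jordan_mx (hermitian_mx X) (hermitian_mx Y)).

Definition idem (i : 'I_3) : A := ([ffun j => (j == i)%:R], 0).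

Definition iota_ (i : 'I_3) (a : C) : A :=
  (0, [ffun j => if j == i then (2%:R : F) *: a else 0]).

End Albert.

Definition vec4 (x y z t : int) : 'rV[int]_4 := \row_j [:: x; y; z; t]`_j.

Definition adeg (i : 'I_3) : 'rV[int]_4 :=
  nth 0 [:: vec4 1 0 0 0; vec4 0 1 0 0; vec4 (-1) (-1) 0 0] i.
Definition gdeg (i : 'I_3) : 'rV[int]_4 :=
  nth 0 [:: vec4 0 0 1 0; vec4 0 0 0 1; vec4 0 0 (-1) (-1)] i.

(* The degree of iota_i(u_j); the one of iota_i(v_j) is its opposite. *)
Definition udeg (i j : 'I_3) : 'rV[int]_4 :=
  if j == i then gdeg i
  else if j == i + 1 then adeg (i + 2) + gdeg (i + 1)
  else - adeg (i + 1) + gdeg (i + 2).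

Definition iota_deg (i : 'I_3) (b : cayley_index) : 'rV[int]_4 :=
  match b with
  | Ce1 => adeg i
  | Ce2 => - adeg i
  | Cu j => udeg i j
  | Cv j => - udeg i j
  end.

Definition albert_base (F : fieldType) (k : 'I_3 + 'I_3 * cayley_index) : albert F :=
  match k with
  | inl i => idem F i
  | inr (i, b) => iota_ i (cbase F b)
  end.

Definition albert_deg (k : 'I_3 + 'I_3 * cayley_index) : 'rV[int]_4 :=
  match k with
  | inl _ => 0
  | inr (i, b) => iota_deg i b
  end.

Definition cartan_grading (F : fieldType) (g : 'rV[int]_4) : {vspace albert F} :=
  (\sum_(k : 'I_3 + 'I_3 * cayley_index | albert_deg k == g)
     <[albert_base F k]>)%VS.

Section RootSystem.
Variables (F : fieldType) (R : realType).

Local Notation E := 'rV[R]_4.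
Definition lattice_incl (z : 'rV[int]_4) : E := map_mx intr z.

(* Degrees of the nonzero homogeneous elements of iota_1(C). *)
Definition supp_iota1 : set 'rV[int]_4 :=
  [set g | exists2 c : cayley F,
     iota_ 0 c != 0 & iota_ 0 c \in cartan_grading F g].

Definition Phi : set E :=
  (lattice_incl @`
    (supp (cartan_grading F) `|`
     [set z | exists al be, [/\ supp_iota1 al, supp_iota1 be,
        al <> be, al <> - be & z = al + be]])) `\ 0.

Definition aut_Phi : set 'End(E) :=
  [set mu | GL mu /\ mu @` Phi = Phi].

(* W(Gamma) as a subset of GL(E): the class C of an automorphism of the grading
   acts on E as the R-linear extension of the automorphism u of Z^4 that C
   induces. *)
Definition weyl_GL : set 'End(E) :=
  [set mu | GL mu /\
     exists2 C, weyl_group (@amul F) (cartan_grading F) C &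
     exists2 u : {additive 'rV[int]_4 -> 'rV[int]_4},
       weyl_induces (cartan_grading F) C u &
       forall z, mu (lattice_incl z) = lattice_incl (u z)].

End RootSystem.

Arguments Phi : clear implicits.
Arguments aut_Phi : clear implicits.
Arguments weyl_GL : clear implicits.

(* Main.v *)
From HB Require Import structures.
Require Import Defs.
From mathcomp Require Import all_boot all_order all_algebra.
From mathcomp Require Import classical_sets reals.
From mathcomp Require Import ring.
Import GRing.Theory.
Local Open Scope ring_scope.

(** Both groups turn out to be the group of all linear maps that permute the
    24 short roots, that is, the nonzero degrees of the Cartan grading.

    An element of the Weyl group permutes the support of the grading, hence the
    short roots. A long root is the sum of two perpendicular short roots, and
    perpendicularity of two short roots a, b can be read off the support: none
    of a + b and a - b is zero or a short root. So an additive map that permutes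
    the short roots permutes the long ones too, and W(Gamma) is contained in
    Aut Phi ([induces_of_weyl], [aut_of_induces]).

    Conversely, the short roots are recognized inside Phi by their root strings
    ([short_rootE]), so an element mu of Aut Phi permutes them by some p
    ([induces_of_aut]). It remains to produce an automorphism of the Albert
    algebra that permutes the components of the grading as p permutes their
    degrees ([weyl_of_induces]). There are 1152 possible p, but five
    automorphisms are enough to generate all of them. Each sends every basis
    vector of the algebra to a basis vector up to sign:
    - the cyclic permutation of the three blocks iota_i(C);
    - the exchange of two blocks combined with an anti-automorphism of the
      Cayley algebra C;
    - two automorphisms of C that fix e_1 and e_2, a 3-cycle and a transposition
      of the indices of the u_i and v_i, applied on all blocks;
    - a triple of isometries of C, one for each block, built from the
      multiplications by an element of norm 1 and related by a Moufang identity.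
    That they generate is the orbit-stabilizer argument for the chain of
    pointwise stabilizers of the four short roots which form the standard basis
    of Z^4: the orbits have lengths 24, 8, 3, 2, and each is swept out by those
    of the five symmetries that fix the previous basis vectors ([align]). An
    additive map that fixes a basis is the identity, so p is a word in the five
    symmetries ([induced_word]). *)

Set Implicit Arguments.
Unset Strict Implicit.
Unset Printing Implicit Defensive.

(** * Indices *)

(** The pair (i, b) stands for the basis vector iota_i(b) of the Albert algebra
    and for its degree, which is a short root. *)
Notation short := ('I_3 * cayley_index)%type.

Lemma I3_ind (P : 'I_3 -> Prop) : P 0 -> P 1 -> P 2 -> forall i, P i.
Proof.
move=> P0 P1 P2 [[|[|[|//]]] lti].
- by rewrite (_ : Ordinal lti = 0) //; apply/val_inj.
- by rewrite (_ : Ordinal lti = 1) //; apply/val_inj.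
- by rewrite (_ : Ordinal lti = 2) //; apply/val_inj.
Qed.

(** Explicit enumerations of the index types: unlike [enum], they can be
    computed by the kernel, which turns quantification over indices into
    evaluation of [all]. *)
Definition I3_list : seq 'I_3 := [:: 0; 1; 2].

Lemma mem_I3_list i : i \in I3_list.
Proof. by elim/I3_ind: i. Qed.

Definition cayley_list : seq cayley_index :=
  [:: Ce1; Ce2] ++ map Cu I3_list ++ map Cv I3_list.

Lemma mem_cayley_list b : b \in cayley_list.
Proof. by case: b => [||i|i] //; elim/I3_ind: i. Qed.

Definition short_list : seq short :=
  [seq (i, b) | i <- I3_list, b <- cayley_list].

Lemma mem_short_list k : k \in short_list.
Proof.
by case: k => i b; apply: allpairs_f; [apply: mem_I3_list | apply: mem_cayley_list].
Qed.

(** A basis vector of the Cayley algebra with a sign, [true] meaning minus. *)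
Notation signed_index := (bool * cayley_index)%type.

Lemma big_I3 (V : nmodType) (f : 'I_3 -> V) : \sum_i f i = f 0 + f 1 + f 2.
Proof.
by rewrite !big_ord_recr big_ord0 /= add0r; do 2?congr (_ + _); congr f; apply/val_inj.
Qed.

Lemma big_cayley (V : nmodType) (f : cayley_index -> V) :
  \sum_b f b = f Ce1 + f Ce2 + (f (Cu 0) + f (Cu 1) + f (Cu 2))
               + (f (Cv 0) + f (Cv 1) + f (Cv 2)).
Proof.
rewrite (perm_big cayley_list) /=; last first.
  apply: uniq_perm; rewrite ?index_enum_uniq // => b.
  by rewrite mem_cayley_list mem_index_enum.
by rewrite !big_cons big_nil addr0 !addrA.
Qed.

(** * The short and the long roots, in integer coordinates *)

(** Quadruples of integers replace row vectors wherever roots are compared by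
    computation, because matrices do not reduce. *)
Notation Z4 := (int * int * int * int)%type.

Definition adeg4 (i : 'I_3) : Z4 :=
  nth 0 [:: (1, 0, 0, 0); (0, 1, 0, 0); (-1, -1, 0, 0)] i.
Definition gdeg4 (i : 'I_3) : Z4 :=
  nth 0 [:: (0, 0, 1, 0); (0, 0, 0, 1); (0, 0, -1, -1)] i.
Definition udeg4 (i j : 'I_3) : Z4 :=
  if j == i then gdeg4 i
  else if j == i + 1 then adeg4 (i + 2) + gdeg4 (i + 1)
  else - adeg4 (i + 1) + gdeg4 (i + 2).
Definition deg4 (k : short) : Z4 :=
  match k.2 with
  | Ce1 => adeg4 k.1 | Ce2 => - adeg4 k.1
  | Cu j => udeg4 k.1 j | Cv j => - udeg4 k.1 j
  end.

Definition row4 (z : Z4) : 'rV[int]_4 := vec4 z.1.1.1 z.1.1.2 z.1.2 z.2.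

Fact row4_is_additive : zmod_morphism row4.
Proof.
case=> [[[x y] z] t] [[[x' y'] z'] t']; apply/rowP => -[[|[|[|[|//]]]] lti];
  by rewrite !mxE.
Qed.
HB.instance Definition _ := GRing.isZmodMorphism.Build Z4 'rV[int]_4 row4 row4_is_additive.

Lemma iota_deg_row4 i b : iota_deg i b = row4 (deg4 (i, b)).
Proof.
have adegE j : adeg j = row4 (adeg4 j) by elim/I3_ind: j.
have gdegE j : gdeg j = row4 (gdeg4 j) by elim/I3_ind: j.
have udegE j : udeg i j = row4 (udeg4 i j).
  by rewrite /udeg /udeg4 !adegE !gdegE -raddfN -!raddfD; do 2![case: ifP => _ //].
by case: b => [||j|j] /=; rewrite ?adegE ?udegE ?raddfN.
Qed.

Definition short_roots : seq Z4 := map deg4 short_list.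
Definition long_roots : seq Z4 :=
  let s := [seq deg4 (0, b) | b <- cayley_list] in
  [seq p.1 + p.2 | p <- [seq (x, y) | x <- s, y <- s] & (p.1 != p.2) && (p.1 != - p.2)].

Definition unrow4 (z : 'rV[int]_4) : Z4 := (z 0 0, z 0 1, z 0 2, z 0 3).

Lemma row4K : cancel row4 unrow4.
Proof. by case=> [[[x y] z] t]; rewrite /unrow4 !mxE. Qed.

Lemma row4_inj : injective row4.
Proof. exact: can_inj row4K. Qed.

Lemma unrow4K : cancel unrow4 row4.
Proof.
move=> z; apply/rowP => -[[|[|[|[|//]]]] lti]; rewrite mxE /=;
  by congr (z _ _); apply/val_inj.
Qed.

HB.instance Definition _ := GRing.isZmodMorphism.Build 'rV[int]_4 Z4 unrow4
  (can2_zmod_morphism row4K unrow4K).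

(** For short roots a and b, which of a + b and a - b vanish or are short roots
    determines the angle between a and b; [adjacency] thus records the inner
    product without mentioning one. *)
Definition kind (x : Z4) := (x == 0, x \in short_roots).

Definition adjacency (k l : short) :=
  (kind (deg4 k + deg4 l), kind (deg4 k - deg4 l)).

Definition perpendicular (k l : short) :=
  adjacency k l == ((false, false), (false, false)).

Lemma perpendicular_long k l : perpendicular k l -> deg4 k + deg4 l \in long_roots.
Proof.
have /allP/(_ k (mem_short_list k))/allP/(_ l (mem_short_list l))/implyP// :
  all (fun k => all (fun l => perpendicular k l ==> (deg4 k + deg4 l \in long_roots)) short_list)
    short_list by vm_compute.
Qed.

(** The 8 degrees of iota_1(C) form a frame of 4 lines that are perpendicular
    to each other. *)
Lemma long_rootsP z : z \in long_roots ->
  exists b c, z = deg4 (0, b) + deg4 (0, c) /\ perpendicular (0, b) (0, c).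
Proof.
have /allP orth_bc : all (fun b => all (fun c =>
    (deg4 (0, b) != deg4 (0, c)) && (deg4 (0, b) != - deg4 (0, c)) ==>
    perpendicular (0, b) (0, c)) cayley_list) cayley_list by vm_compute.
case/mapP=> -[x y]; rewrite mem_filter => /andP[neq].
case/allpairsP=> -[x' y'] [/mapP[b bL def_b] /mapP[c cL def_c] [def_x def_y]] ->.
move: def_b def_c; rewrite -[(x', y').1]/x' -[(x', y').2]/y' -def_x -def_y => def_b def_c.
exists b, c; rewrite -def_b -def_c; split=> //.
by move: (orth_bc _ bL) => /allP/(_ _ cL)/implyP; rewrite -def_b -def_c; apply.
Qed.

Definition all_roots := short_roots ++ long_roots.

Lemma roots_neq0 z : z \in all_roots -> z != 0.
Proof. by apply: contraTneq => ->; vm_compute. Qed.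

(** A long root a at 135 degrees from a short root z gives the string a, a + z,
    a + 2z; no string in the direction of a long root has three nonzero members. *)
Lemma short_rootE z : z \in all_roots ->
  (z \in short_roots) =
    has (fun x => (x + z \in all_roots) && (x + z + z \in all_roots)) all_roots.
Proof.
by move=> zphi; apply/eqP; move: z zphi; apply/allP; vm_compute.
Qed.

Lemma deg4_inj : injective deg4.
Proof.
move=> k l /eqP eqd.
have /allP/(_ k (mem_short_list k))/allP/(_ l (mem_short_list l))/implyP/(_ eqd)/eqP// :
  all (fun k => all (fun l => (deg4 k == deg4 l) ==> (k == l)) short_list) short_list.
by vm_compute.
Qed.

Lemma short_rootsP z : reflect (exists k, z = deg4 k) (z \in short_roots).
Proof.
apply: (iffP mapP) => [[k _ ->]|[k ->]]; exists k => //; exact: mem_short_list.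
Qed.

Lemma mem_deg4_roots k : deg4 k \in all_roots.
Proof. by rewrite mem_cat; apply/orP; left; apply/short_rootsP; exists k. Qed.

(** * Additive maps that permute the short roots *)

Definition scale4 (V : zmodType) (x y z t : V) (q : Z4) : V :=
  x *~ q.1.1.1 + y *~ q.1.1.2 + z *~ q.1.2 + t *~ q.2.

(** The degrees of iota_1(e_1), iota_2(e_1), iota_1(u_1) and iota_2(u_2) are the
    standard basis of Z^4, so [ext d] is the additive map that takes there the
    values prescribed by [d]. *)
Definition ext (V : zmodType) (d : short -> V) :=
  scale4 (d (0, Ce1)) (d (1, Ce1)) (d (0, Cu 0)) (d (1, Cu 1)).

Fact ext_is_additive (V : zmodType) (d : short -> V) : zmod_morphism (ext d).
Proof.
have sumB (a b c e a' b' c' e' : V) :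
    (a - a') + (b - b') + (c - c') + (e - e') = (a + b + c + e) - (a' + b' + c' + e').
  by rewrite !opprD !addrA [RHS](ACl (1*5*2*6*3*7*4*8))%AC.
by move=> z z'; rewrite /ext /scale4 /= !mulrzBr sumB.
Qed.
HB.instance Definition _ V d := GRing.isZmodMorphism.Build Z4 V (ext d) (@ext_is_additive V d).

Lemma ext_deg4 z : ext deg4 z = z.
Proof.
have pairMz (U W : zmodType) (u : U) (w : W) n : (u, w) *~ n = (u *~ n, w *~ n).
  rewrite [LHS]surjective_pairing; congr (_, _).
    exact: (raddfMz (fst : {additive U * W -> U})).
  exact: (raddfMz (snd : {additive U * W -> W})).
case: z => [[[x y] z] t]; rewrite /ext /scale4 /= /deg4 /= !pairMz.
rewrite !mul0rz !intz.
transitivity (x + 0 + 0 + 0, 0 + y + 0 + 0, 0 + 0 + z + 0, 0 + 0 + 0 + t); first by [].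
by rewrite !addr0 !add0r.
Qed.

Lemma raddf_scale4 (U V : zmodType) (h : {additive U -> V}) x y z t q :
  h (scale4 x y z t q) = scale4 (h x) (h y) (h z) (h t) q.
Proof. by rewrite /scale4 !raddfD !raddfMz. Qed.

Lemma additive_ext (V : zmodType) (h : {additive Z4 -> V}) z : h z = ext (h \o deg4) z.
Proof. by rewrite -[in LHS](ext_deg4 z); apply: raddf_scale4. Qed.

Definition isometric (p : short -> short) :=
  forall k l, adjacency (p k) (p l) = adjacency k l.

Lemma isometric_inj p : isometric p -> injective p.
Proof.
move=> iso_p k l eqp; apply/deg4_inj/eqP; rewrite -subr_eq0.
by have [_ _ <- _] := iso_p k l; rewrite eqp subrr.
Qed.

(** A comparison of [h] and [h'] through [p] transports the finite set of short
    roots to itself, hence also the relations that define [adjacency]. It is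
    used with [h'] the inclusion of Z^4 in R^4 and [h] its composite with a
    linear map. *)
Lemma isometric_of_additive (V : zmodType) (h h' : {additive Z4 -> V}) p :
  injective h -> injective h' -> (forall k, h (deg4 k) = h' (deg4 (p k))) ->
  isometric p.
Proof.
move=> inj_h inj_h' hp.
have inj_p : injective p by move=> k l eqp; apply/deg4_inj/inj_h; rewrite !hp eqp.
move=> k l.
have kindE x y : h x = h' y -> kind x = kind y.
  move=> hxy; congr (_, _).
    by rewrite -(inj_eq inj_h) -(inj_eq inj_h') hxy !raddf0.
  apply/short_rootsP/short_rootsP => -[m def_m].
    exists (p m); apply: inj_h'; rewrite -hp -hxy def_m //.
  have [q _ pq] := injF_bij inj_p; exists (q m); apply: inj_h.
  by rewrite hxy hp pq def_m.
by rewrite /adjacency; congr (_, _); apply/esym/kindE;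
  rewrite ?raddfB ?raddfD /= !hp.
Qed.

(** The long roots follow the short ones, being the sums of two perpendicular
    short roots. *)
Lemma isometric_roots (V : zmodType) (h h' : {additive Z4 -> V}) p :
  isometric p -> (forall k, h (deg4 k) = h' (deg4 (p k))) ->
  forall z, z \in all_roots -> exists2 z', z' \in all_roots & h z = h' z'.
Proof.
move=> iso_p hp z; rewrite mem_cat => /orP[/short_rootsP[k ->]|/long_rootsP[b [c [->]]]].
  by exists (deg4 (p k)); rewrite ?mem_deg4_roots.
rewrite /perpendicular -iso_p => orth_p.
exists (deg4 (p (0, b)) + deg4 (p (0, c))); last by rewrite !raddfD /= !hp.
by rewrite mem_cat perpendicular_long ?orbT.
Qed.

(** * Five symmetries of the short roots *)

(** The multiplication table of C: products of basis vectors are zero, or basis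
    vectors up to sign. *)
Definition mul_index (b c : cayley_index) : option (bool * cayley_index) :=
  match b, c with
  | Ce1, Ce1 => Some (false, Ce1)
  | Ce2, Ce2 => Some (false, Ce2)
  | Ce1, Cu i => Some (false, Cu i)
  | Ce2, Cv i => Some (false, Cv i)
  | Cu i, Ce2 => Some (false, Cu i)
  | Cv i, Ce1 => Some (false, Cv i)
  | Cu i, Cv j => if i == j then Some (true, Ce1) else None
  | Cv i, Cu j => if i == j then Some (true, Ce2) else None
  | Cu i, Cu j => if j == i + 1 then Some (false, Cv (i + 2))
                  else if i == j + 1 then Some (true, Cv (j + 2)) else None
  | Cv i, Cv j => if j == i + 1 then Some (false, Cu (i + 2))
                  else if i == j + 1 then Some (true, Cu (j + 2)) else None
  | _, _ => None
  end.

Definition dual_index (b : cayley_index) :=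
  match b with Ce1 => Ce2 | Ce2 => Ce1 | Cu i => Cv i | Cv i => Cu i end.
Definition conj_sign (b : cayley_index) :=
  match b with Cu _ | Cv _ => true | _ => false end.
Definition conj_index (b : cayley_index) :=
  match b with Ce1 => Ce2 | Ce2 => Ce1 | _ => b end.

Lemma conj_indexK : involutive conj_index. Proof. by case. Qed.
Lemma dual_indexK : involutive dual_index. Proof. by case. Qed.

(** The para-Hurwitz product a * b = conj(a) conj(b) is the one by which
    iota_i(C) multiplies iota_{i+1}(C) into iota_{i+2}(C). *)
Definition star_index (b c : cayley_index) : option signed_index :=
  omap (fun r => (conj_sign b (+) conj_sign c (+) r.1, r.2))
    (mul_index (conj_index b) (conj_index c)).

Inductive symmetry := Block_cycle | Block_flip | Index_cycle | Index_swap | Triality.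

Definition map_uv (f : 'I_3 -> 'I_3) (b : cayley_index) :=
  match b with Cu i => Cu (f i) | Cv i => Cv (f i) | _ => b end.

(** Left and right multiplication by x = u_1 + v_1, an element of norm 1: each
    basis vector is annihilated by one of the two summands. *)
Definition lmul0 (b : cayley_index) : bool * cayley_index :=
  if mul_index (Cu 0) b is Some r then r else odflt (false, b) (mul_index (Cv 0) b).
Definition rmul0 (b : cayley_index) : bool * cayley_index :=
  if mul_index b (Cu 0) is Some r then r else odflt (false, b) (mul_index b (Cv 0)).

(** The block i is moved to [block g i]; the block that is moved to i is
    [unblock g i]. *)
Definition block (g : symmetry) (i : 'I_3) : 'I_3 :=
  match g with Block_cycle => i + 1 | Block_flip => - i | _ => i end.
Definition unblock (g : symmetry) (i : 'I_3) : 'I_3 :=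
  match g with Block_cycle => i - 1 | Block_flip => - i | _ => i end.

Definition signed_comp (f g : cayley_index -> bool * cayley_index) b :=
  ((g b).1 (+) (f (g b).2).1, (f (g b).2).2).

(** The signed permutation of the basis of C by which [g] maps into the block i.

    With omega the automorphism of C that exchanges e_1 with e_2 and u_i with
    v_i, [Block_flip] uses the anti-automorphism a |-> conj(omega(a)). The sign in
    [Index_swap] compensates for the orientation u_i u_{i+1} = v_{i+2}, which an
    odd permutation of the indices reverses. [Triality] composes omega with
    a |-> x(ax), a |-> ax, a |-> xa on the blocks 1, 2, 3; the Moufang identity
    (xa)(bx) = x(ab)x makes this compatible with the products between blocks.
    The factor omega makes [Triality] preserve the line of iota_1(e_1), so that
    it belongs to the stabilizer of the first basis vector in [align]. *)
Definition entry (g : symmetry) (i : 'I_3) : cayley_index -> bool * cayley_index :=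
  match g with
  | Block_cycle => fun b => (false, b)
  | Block_flip => fun b => (conj_sign b, conj_index (dual_index b))
  | Index_cycle => fun b => (false, map_uv (+%R 1) b)
  | Index_swap => fun b =>
      (match b with Cu j | Cv j => j == 0 | _ => false end, map_uv -%R b)
  | Triality =>
      signed_comp (fun b => (false, dual_index b))
        (nth lmul0 [:: signed_comp lmul0 rmul0; rmul0] i)
  end.

Definition act (g : symmetry) (k : short) : short :=
  (block g k.1, (entry g (block g k.1) k.2).2).

Definition act_word (w : seq symmetry) (k : short) := foldr act k w.

Definition symmetry_list := [:: Block_cycle; Block_flip; Index_cycle; Index_swap; Triality].

Lemma unblockK g : cancel (unblock g) (block g).
Proof. by case: g => i //=; [apply: subrK | apply: opprK]. Qed.
Lemma blockK g : cancel (block g) (unblock g).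
Proof. by case: g => i //=; [apply: addrK | apply: opprK]. Qed.

Lemma act_deg4 g k : deg4 (act g k) = ext (fun k => deg4 (act g k)) (deg4 k).
Proof.
have /allP/(_ _ (mem_short_list k))/eqP// :
  all (fun k => deg4 (act g k) == ext (fun k => deg4 (act g k)) (deg4 k)) short_list.
by case: g; vm_compute.
Qed.

Lemma isometric_act g : isometric (act g).
Proof.
move=> k l.
have /allP/(_ k)/(_ (mem_short_list k))/allP/(_ _ (mem_short_list l))/eqP// :
  all (fun k => all (fun l =>
    adjacency (act g k) (act g l) == adjacency k l) short_list) short_list.
by case: g; vm_compute.
Qed.

Lemma isometric_act_word w : isometric (act_word w).
Proof. by elim: w => [|g w IHw] //= k l; rewrite isometric_act IHw. Qed.

(** * Every symmetry of the short roots is a word in the five *)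

(** The points from which [b] is reached by at most [n] steps of [gs]. *)
Definition basin (gs : seq symmetry) b n :=
  iter n (fun s => s ++ [seq k <- short_list | has (fun g => act g k \in s) gs]) [:: b].

Definition fixes (l : seq short) (g : symmetry) := all (fun k => act g k == k) l.

Lemma basinP (l : seq short) gs b n k : all (fixes l) gs -> k \in basin gs b n ->
  exists2 w, {in l, act_word w =1 id} & act_word w k = b.
Proof.
have fix_has P Q : all P gs -> has Q gs -> exists2 g, P g & Q g.
  elim: gs => //= g gs' IHgs /andP[Pg Pgs] /orP[Qg|]; [by exists g | exact: IHgs].
move=> fix_gs; elim: n => [|n IHn] in k *; first by rewrite inE => /eqP->; exists [::].
rewrite /basin iterS -/(basin gs b n) mem_cat => /orP[/IHn//|].
rewrite mem_filter mem_short_list andbT => /(fix_has _ _ fix_gs)[g fix_g /IHn[w fix_w wgk]].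
exists (rcons w g); last by rewrite /act_word foldr_rcons.
by move=> j lj; rewrite /act_word foldr_rcons (eqP (allP fix_g j lj)); apply: fix_w.
Qed.

(** One level of a stabilizer chain. A symmetry that fixes [l] can only send [b]
    to a [k] that has the same inner products with [l] as [b]; the second
    condition says that the orbit of [b] under [gs] contains all these [k]. *)
Definition orbit_step (l : seq short) gs b n :=
  all (fixes l) gs &&
  all (fun k => all (fun j => adjacency j k == adjacency j b) l ==> (k \in basin gs b n))
    short_list.

(** Composing with a word in the stabilizer of [l] corrects the image of [b] and
    keeps what has been achieved on [l]. *)
Lemma align_step l gs b n p : orbit_step l gs b n -> isometric p ->
  (exists w, {in l, act_word w \o p =1 id}) ->
  exists w, {in b :: l, act_word w \o p =1 id}.
Proof.
case/andP=> fix_gs /allP orbit_b iso_p [w0 fix_w0p].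
have /implyP reach_b := orbit_b _ (mem_short_list (act_word w0 (p b))).
have [|w fix_w wb] := basinP fix_gs (reach_b _).
  apply/allP => j lj; rewrite -{1}(fix_w0p j lj).
  by rewrite isometric_act_word iso_p.
have act_cat k : act_word (w ++ w0) k = act_word w (act_word w0 k) by apply: foldr_cat.
exists (w ++ w0) => k; rewrite inE /= act_cat => /predU1P[-> //|lk].
by have /= -> := fix_w0p k lk; apply: fix_w.
Qed.

(** The orbits in the four steps have 24, 8, 3 and 2 elements. *)
Lemma align p : isometric p ->
  exists w, {in [:: (1, Cu 1); (0, Cu 0); (1, Ce1); (0, Ce1)], act_word w \o p =1 id}.
Proof.
(* The last argument is the number of rounds after which the orbit is full. *)
have step1 : orbit_step [::] symmetry_list (0, Ce1) 6 by vm_compute.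
have step2 : orbit_step [:: (0, Ce1)]
  [:: Block_flip; Index_cycle; Index_swap; Triality] (1, Ce1) 4 by vm_compute.
have step3 : orbit_step [:: (1, Ce1); (0, Ce1)]
  [:: Index_cycle; Index_swap] (0, Cu 0) 2 by vm_compute.
have step4 : orbit_step [:: (0, Cu 0); (1, Ce1); (0, Ce1)]
  [:: Index_swap] (1, Cu 1) 1 by vm_compute.
move=> iso_p; apply: (align_step step4 iso_p); apply: (align_step step3 iso_p).
by apply: (align_step step2 iso_p); apply: (align_step step1 iso_p); exists [::].
Qed.

Definition induced (p : short -> short) :=
  exists u : {additive Z4 -> Z4}, forall k, deg4 (p k) = u (deg4 k).

Lemma induced_comp p q : induced p -> induced q -> induced (p \o q).
Proof.
by case=> u up [v vq]; exists (u \o v : {additive _ -> _}) => k /=; rewrite up vq.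
Qed.

Lemma induced_act_word w : induced (act_word w).
Proof.
elim: w => [|g w IHw]; first by exists (idfun : {additive _ -> _}).
by apply: (@induced_comp (act g)) IHw; exists (ext (deg4 \o act g)) => k; apply: act_deg4.
Qed.

Lemma induced_word p : induced p -> isometric p -> exists w, act_word w \o p =1 id.
Proof.
move=> ind_p /align[w fix_wp]; exists w => k; apply: deg4_inj.
have [u uE] := induced_comp (induced_act_word w) ind_p.
rewrite uE additive_ext -[RHS]ext_deg4 /ext /scale4 /= -!uE.
by rewrite !fix_wp.
Qed.

(** * The Cayley algebra *)

Section CayleyAlgebra.
Variable F : fieldType.
Local Notation C := (cayley F).

Definition signed_base (r : signed_index) : C := (-1) ^+ r.1 *: cbase F r.2.
Definition opt_base (o : option signed_index) : C := oapp signed_base 0 o.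

Lemma cmul_baseE b c : cmul_base F b c = opt_base (mul_index b c).
Proof.
case: b c => [||i|i] [||j|j] //=; rewrite /opt_base /signed_base;
  by do ?[case: ifP => _ /=]; rewrite ?scale1r ?scaleN1r.
Qed.

Fact cmul_is_linear (x : C) : linear (cmul x).
Proof.
move=> a y z; rewrite /cmul scaler_sumr -big_split; apply: eq_bigr => b _.
rewrite scaler_sumr -big_split; apply: eq_bigr => c _.
by rewrite /= !ffunE /= scalerA -[RHS]scalerDl; congr (_ *: _); rewrite mulrDr mulrCA.
Qed.
HB.instance Definition _ x := GRing.isLinear.Build F C C *:%R (cmul x) (cmul_is_linear x).

Fact cmulr_is_linear (y : C) : linear (fun x => cmul x y).
Proof.
move=> a x z; rewrite /cmul scaler_sumr -big_split; apply: eq_bigr => b _.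
rewrite scaler_sumr -big_split; apply: eq_bigr => c _.
by rewrite /= !ffunE /= scalerA -[RHS]scalerDl; congr (_ *: _); rewrite mulrDl mulrA.
Qed.

Lemma cmul_base_base b c : cmul (cbase F b) (cbase F c) = opt_base (mul_index b c).
Proof.
rewrite /cmul (bigD1 b) //= (bigD1 c) //= !ffunE !eqxx mulr1 scale1r cmul_baseE.
rewrite big1 => [|d neq]; last by rewrite !ffunE (negPf neq) mulr0 scale0r.
rewrite addr0 big1 ?addr0 // => d neq; rewrite big1 // => e _.
by rewrite !ffunE (negPf neq) mul0r scale0r.
Qed.

Lemma cpolarE (x y : C) : cpolar x y = \sum_b x b * y (dual_index b).
Proof.
by rewrite /cpolar /cnorm big_cayley !big_I3 !ffunE /=; ring.
Qed.

Lemma cbaseE b c : cbase F b c = (c == b)%:R. Proof. exact: ffunE. Qed.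

Lemma cconjE (x : C) b : cconj x b = (-1) ^+ conj_sign b * x (conj_index b).
Proof.
have -> : cconj x b = cpolar x (cone F) * cone F b - x b by rewrite !ffunE.
rewrite cpolarE big_cayley !ffunE /=.
by case: b => [||i|i] /=; ring.
Qed.

Definition star (x y : C) := cmul (cconj x) (cconj y).

Lemma starE x y : star x y = \sum_b \sum_c (x b * y c) *: opt_base (star_index b c).
Proof.
rewrite /star /cmul (reindex_inj (inv_inj conj_indexK)); apply: eq_bigr => b _.
rewrite (reindex_inj (inv_inj conj_indexK)); apply: eq_bigr => c _.
rewrite !cconjE !conj_indexK cmul_baseE /star_index.
have cs d : conj_sign (conj_index d) = conj_sign d by case: d.
case: mul_index => [[s d]|]; last by rewrite !scaler0.
rewrite /opt_base /= /signed_base !scalerA !cs /=; congr (_ *: _).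
by rewrite !signr_addb; ring.
Qed.

Fact star_is_linear (x : C) : linear (star x).
Proof.
move=> a y z; rewrite !starE scaler_sumr -big_split; apply: eq_bigr => b _.
rewrite scaler_sumr -big_split; apply: eq_bigr => c _.
by rewrite /= !ffunE /= scalerA -[RHS]scalerDl; congr (_ *: _); rewrite mulrDr mulrCA.
Qed.
HB.instance Definition _ x := GRing.isLinear.Build F C C *:%R (star x) (star_is_linear x).

Definition starr (y x : C) := star x y.
Fact starr_is_linear (y : C) : linear (starr y).
Proof.
move=> a x z; rewrite /starr !starE scaler_sumr -big_split; apply: eq_bigr => b _.
rewrite scaler_sumr -big_split; apply: eq_bigr => c _.
by rewrite /= !ffunE /= scalerA -[RHS]scalerDl; congr (_ *: _); rewrite mulrDl mulrA.
Qed.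
HB.instance Definition _ y := GRing.isLinear.Build F C C *:%R (starr y) (starr_is_linear y).

Lemma star_base b c : star (cbase F b) (cbase F c) = opt_base (star_index b c).
Proof.
rewrite starE (bigD1 b) //= (bigD1 c) //= !cbaseE !eqxx mulr1 scale1r.
rewrite big1 => [|d neq]; last by rewrite !cbaseE (negPf neq) mulr0 scale0r.
rewrite addr0 big1 ?addr0 // => d neq; rewrite big1 // => e _.
by rewrite !cbaseE (negPf neq) mul0r scale0r.
Qed.

(** The linear map given by a signed permutation of the basis. *)
Definition monomial (phi : cayley_index -> signed_index) (x : C) : C :=
  \sum_b (x b : F) *: signed_base (phi b).

Fact monomial_is_linear phi : linear (monomial phi).
Proof.
move=> a x y; rewrite /monomial scaler_sumr -big_split; apply: eq_bigr => b _.
by rewrite /= !ffunE [LHS]scalerDl [in RHS]scalerA.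
Qed.
HB.instance Definition _ phi :=
  GRing.isLinear.Build F C C *:%R (monomial phi) (monomial_is_linear phi).

Lemma monomial_base phi b : monomial phi (cbase F b) = signed_base (phi b).
Proof.
rewrite /monomial (bigD1 b) //= cbaseE eqxx scale1r big1 ?addr0 // => c neq.
by rewrite cbaseE (negPf neq) scale0r.
Qed.

Definition monomial_index (phi : cayley_index -> signed_index) (o : option signed_index) :=
  omap (fun r => (r.1 (+) (phi r.2).1, (phi r.2).2)) o.
Definition signed_star (r s : signed_index) : option signed_index :=
  omap (fun q => (r.1 (+) s.1 (+) q.1, q.2)) (star_index r.2 s.2).

Lemma star_signed_base r s :
  star (signed_base r) (signed_base s) = opt_base (signed_star r s).
Proof.
rewrite /signed_base linearZ /= -/(starr _ _) linearZ /= /starr star_base.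
rewrite /signed_star; case: star_index => [q|]; last by rewrite !scaler0.
by rewrite /opt_base /= /signed_base /= !scalerA !signr_addb; congr (_ *: _); ring.
Qed.

Lemma monomial_opt_base phi o : monomial phi (opt_base o) = opt_base (monomial_index phi o).
Proof.
case: o => [r|] /=; last exact: linear0.
by rewrite /opt_base /= linearZ /= monomial_base /signed_base /= scalerA signr_addb.
Qed.

Lemma star_monomial chi psi x y :
  star (monomial chi x) (monomial psi y) =
  \sum_b \sum_c (x b * y c) *: opt_base (signed_star (chi b) (psi c)).
Proof.
rewrite {1}/monomial -/(starr _ _) linear_sum; apply: eq_bigr => b _ /=.
rewrite linearZ /= /starr (linear_sum (star _)) scaler_sumr; apply: eq_bigr => c _ /=.
by rewrite [star _ (y c *: _)]linearZ /= scalerA star_signed_base.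
Qed.

Lemma monomial_star phi x y :
  monomial phi (star x y) =
  \sum_b \sum_c (x b * y c) *: opt_base (monomial_index phi (star_index b c)).
Proof.
rewrite starE linear_sum; apply: eq_bigr => b _; rewrite linear_sum; apply: eq_bigr => c _ /=.
by rewrite linearZ /= monomial_opt_base.
Qed.

(** The basis of C splits into four hyperbolic pairs; a signed permutation is an
    isometry of the norm if it maps pairs to pairs, with equal signs within a
    pair. *)
Definition dual_preserving (phi : cayley_index -> signed_index) := forall b c,
  (c == dual_index b) = ((phi c).2 == dual_index (phi b).2) /\
  (phi (dual_index b)).1 = (phi b).1.

Lemma monomialE phi b x :
  monomial phi x b = \sum_c x c * (-1) ^+ (phi c).1 * (b == (phi c).2)%:R.
Proof.
by rewrite sum_ffunE; apply: eq_bigr => c _; rewrite !ffunE; apply: (mulrA (x c : F)).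
Qed.

Lemma monomial_polar phi : dual_preserving phi ->
  forall x y, cpolar (monomial phi x) (monomial phi y) = cpolar x y.
Proof.
move=> dual_phi x y; rewrite !cpolarE.
under eq_bigr => d _.
  rewrite !monomialE big_distrlr /=.
  over.
rewrite exchange_big; apply: eq_bigr => b _ /=; rewrite exchange_big /=.
rewrite (bigD1 (dual_index b)) //= [X in _ + X]big1 ?addr0 => [|c neq].
  rewrite (bigD1 (phi b).2) //= big1 ?addr0 => [|d /negPf neq]; last first.
    by rewrite neq mulr0 mul0r.
  have [] := dual_phi b (dual_index b); rewrite eqxx => /esym/eqP-> ->.
  by rewrite !eqxx !mulr1 mulrACA -expr2 sqrr_sign mulr1.
rewrite big1 // => d _; have [->|/negPf neqd] := eqVneq d (phi b).2; last by rewrite mulr0 mul0r.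
by have [+ _] := dual_phi b c; rewrite (negPf neq) eq_sym => <-; rewrite !mulr0.
Qed.

(** An isometry of a nondegenerate form is injective. *)
Lemma monomial_inj phi : dual_preserving phi -> forall x, monomial phi x = 0 -> x = 0.
Proof.
move=> dual_phi x phix0; apply/ffunP => b; rewrite [RHS]ffunE.
have: cpolar x (cbase F (dual_index b)) = 0.
  by rewrite -(monomial_polar dual_phi) phix0 cpolarE big1 // => c _; rewrite ffunE mul0r.
rewrite cpolarE (bigD1 b) //= cbaseE eqxx mulr1 big1 ?addr0 // => c neq.
by rewrite cbaseE (inj_eq (inv_inj dual_indexK)) (negPf neq) mulr0.
Qed.

End CayleyAlgebra.

(** * The product of the Albert algebra *)

Section AlbertAlgebra.
Variable F : fieldType.
Local Notation C := (cayley F).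
Local Notation A := (albert F).

Lemma cmulE (x y : C) b :
  cmul x y b = \sum_c \sum_d x c * y d * cmul_base F c d b.
Proof.
rewrite sum_ffunE; apply: eq_bigr => c _.
by rewrite sum_ffunE; apply: eq_bigr => d _; rewrite ffunE.
Qed.

Lemma cmul_e1 (x y : C) : cmul x y Ce1 = x Ce1 * y Ce1 - \sum_i x (Cu i) * y (Cv i).
Proof.
have e1 c d : cmul_base F c d Ce1 =
    match c, d with Ce1, Ce1 => 1 | Cu i, Cv j => - (i == j)%:R | _, _ => 0 end.
  by case: c d => [||i|i] [||j|j] //=; do ?case: ifP => _; rewrite !ffunE /= ?oppr0.
rewrite cmulE; under eq_bigr => c _ do under eq_bigr => d _ do rewrite e1.
by rewrite !big_cayley /= !(mulr0, add0r, addr0) big_I3 /=; ring.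
Qed.

Lemma cbase_expand (x : C) : x = \sum_b (x b : F) *: cbase F b.
Proof.
apply/ffunP => c; rewrite sum_ffunE (bigD1 c) //= big1 => [|b neq].
  by rewrite !ffunE eqxx addr0; apply/esym/(mulr1 (x c : F)).
by rewrite !ffunE eq_sym (negPf neq); apply: mulr0.
Qed.

Lemma cmulDl (x y z : C) : cmul (x + y) z = cmul x z + cmul y z.
Proof. by have := cmulr_is_linear z 1 x y; rewrite !scale1r. Qed.

Lemma cmulZl a (x z : C) : cmul (a *: x) z = a *: cmul x z.
Proof.
have cmul0l : cmul 0 z = 0.
  by rewrite /cmul big1 // => b _; rewrite big1 // => c _; rewrite ffunE mul0r scale0r.
by have := cmulr_is_linear z a x 0; rewrite cmul0l !addr0.
Qed.

Lemma cmul1l (y : C) : cmul (cone F) y = y.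
Proof.
rewrite [y in LHS]cbase_expand [RHS]cbase_expand (linear_sum (cmul _)); apply: eq_bigr => c _ /=.
rewrite linearZ /= /cone cmulDl /= !cmul_base_base; congr (_ *: _).
by case: c => [||i|i] /=; rewrite ?addr0 ?add0r /opt_base /= /signed_base scale1r.
Qed.

Lemma cmul1r (y : C) : cmul y (cone F) = y.
Proof.
rewrite [y in LHS]cbase_expand [RHS]cbase_expand.
have -> s : cmul (\sum_(b <- s) (y b : F) *: cbase F b) (cone F) =
    \sum_(b <- s) (y b : F) *: cmul (cbase F b) (cone F).
  elim: s => [|b s IHs]; last by rewrite !big_cons cmulDl cmulZl IHs.
  by rewrite !big_nil -[0](scale0r 0) cmulZl !scale0r.
apply: eq_bigr => c _; congr (_ *: _); rewrite /cone linearD /= !cmul_base_base.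
by case: c => [||i|i] /=; rewrite ?addr0 ?add0r /opt_base /= /signed_base scale1r.
Qed.

Lemma cpolar_mulr (x y : C) : cmul x (cconj y) Ce1 + cmul y (cconj x) Ce1 = cpolar x y.
Proof. by rewrite !cmul_e1 !big_I3 cpolarE big_cayley !cconjE /=; ring. Qed.

Lemma cpolar_mull (x y : C) : cmul (cconj x) y Ce1 + cmul (cconj y) x Ce1 = cpolar x y.
Proof. by rewrite !cmul_e1 !big_I3 cpolarE big_cayley !cconjE /=; ring. Qed.

(** The product in terms of the parameters (alpha_i, a_i). It is written
    uniformly in the index modulo 3, so that a permutation of the blocks acts on
    it by substitution. *)
Definition albert_mul (X Y : A) : A :=
  ([ffun i => X.1 i * Y.1 i + 2^-1 * (cpolar (X.2 (i + 1)) (Y.2 (i + 1))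
       + cpolar (X.2 (i + 2)) (Y.2 (i + 2))) : F^o],
   [ffun i => 2^-1 *: (star (X.2 (i + 1)) (Y.2 (i + 2))
       + star (Y.2 (i + 1)) (X.2 (i + 2))
       + (X.1 (i + 1) + X.1 (i + 2)) *: Y.2 i
       + (Y.1 (i + 1) + Y.1 (i + 2)) *: X.2 i) : C]).

Hypothesis two_neq0 : (2 : F) != 0.

Lemma amulE (X Y : A) : amul X Y = albert_mul X Y.
Proof.
have I3E : ((1 + 1 = 2 :> 'I_3)%R * (1 + 2 = 0 :> 'I_3)%R *
            (2 + 1 = 0 :> 'I_3)%R * (2 + 2 = 1 :> 'I_3)%R)%type.
  by do ![split]; apply/val_inj.
case: X Y => [al a] [be b]; congr (_, _); apply/ffunP; elim/I3_ind;
  rewrite !ffunE ?(add0r, I3E) !mxE !big_I3 !mxE /= ?(cmul1l, cmul1r, cmulZl, linearZ) /=.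
1-3: rewrite !ffunE /GRing.scale /=.
- by rewrite -(cpolar_mulr (a 1)) -cpolar_mull; field.
- by rewrite -(cpolar_mulr (a 2)) -cpolar_mull; field.
- by rewrite -(cpolar_mulr (a 0)) -cpolar_mull; field.
all: rewrite ?cmul1r; congr (_ *: _); apply/ffunP => c.
all: by rewrite !ffunE /GRing.scale /= /star; ring.
Qed.

End AlbertAlgebra.

(** * The five symmetries come from automorphisms *)

(** A permutation of Z/3 either preserves or reverses the cyclic order of the
    blocks, and the factors of a product between blocks are exchanged in the
    latter case. *)
Definition reverses g := if g is Block_flip then true else false.

Lemma unblockD g i :
  (unblock g (i + 1), unblock g (i + 2)) =
    if reverses g then (unblock g i + 2, unblock g i + 1)
    else (unblock g i + 1, unblock g i + 2).
Proof.
by case: g; elim/I3_ind: i => //=; congr (_, _); apply/val_inj.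
Qed.

Lemma all3P (P : 'I_3 -> cayley_index -> cayley_index -> bool) :
  all (fun i => all (fun b => all (P i b) cayley_list) cayley_list) I3_list ->
  forall i b c, P i b c.
Proof.
move=> /allP h i b c.
by have /allP/(_ b (mem_cayley_list b))/allP/(_ c (mem_cayley_list c)) := h i (mem_I3_list i).
Qed.

Lemma entry_dual g i : dual_preserving (entry g i).
Proof.
move=> b c; pose P (i : 'I_3) b c :=
  ((c == dual_index b) == ((entry g i c).2 == dual_index (entry g i b).2)) &&
  ((entry g i (dual_index b)).1 == (entry g i b).1).
suff /andP[/eqP-> /eqP->] : P i b c by [].
by apply: all3P; case: g @P; vm_compute.
Qed.

(** The triples of signed permutations are related triples for the para-Hurwitz
    product, in the sense of triality; [Block_flip] has one that reverses
    products. *)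
Lemma entry_triple g i b c :
  monomial_index (entry g i) (star_index b c) =
    if reverses g then signed_star (entry g (i + 1) c) (entry g (i + 2) b)
    else signed_star (entry g (i + 1) b) (entry g (i + 2) c).
Proof.
pose P i b c :=
  monomial_index (entry g i) (star_index b c) ==
    if reverses g then signed_star (entry g (i + 1) c) (entry g (i + 2) b)
    else signed_star (entry g (i + 1) b) (entry g (i + 2) c).
suff /eqP : P i b c by [].
by apply: all3P; case: g @P; vm_compute.
Qed.

(** The permutation of the basis of the Albert algebra: the idempotents follow
    their blocks. *)
Definition relabel g (x : 'I_3 + short) : 'I_3 + short :=
  match x with inl i => inl (block g i) | inr k => inr (act g k) end.

Lemma relabel_inj g : injective (relabel g).
Proof.
move=> [i|k] [j|l] //= eq_xy; congr (_ _).
  exact: (can_inj (blockK g)) (inl_inj eq_xy).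
exact: (isometric_inj (isometric_act g)) (inr_inj eq_xy).
Qed.

Lemma relabel_inl w i : foldr relabel (inl i) w = inl (foldr block i w).
Proof. by elim: w => //= g w ->. Qed.

Lemma relabel_inr w k : foldr relabel (inr k) w = inr (act_word w k).
Proof. by elim: w => //= g w ->. Qed.

Section Realization.
Variable F : fieldType.
Local Notation C := (cayley F).
Local Notation A := (albert F).

(** On blocks the permutation appears as [unblock], because the parameters are
    read at their target. *)
Definition realize g (X : A) : A :=
  ([ffun j => X.1 (unblock g j) : F^o],
   [ffun j => monomial (entry g j) (X.2 (unblock g j)) : C]).

Fact realize_is_linear g : linear (realize g).
Proof.
move=> a X Y; congr (_, _); apply/ffunP => j; rewrite !ffunE //.
by rewrite linearP.
Qed.
HB.instance Definition _ g := GRing.isLinear.Build F A A *:%R (realize g) (realize_is_linear g).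

Lemma realize_inj g X : realize g X = 0 -> X = 0.
Proof.
case=> /ffunP X1 /ffunP X2.
rewrite [X]surjective_pairing; congr (_, _); apply/ffunP => i.
  by have := X1 (block g i); rewrite !ffunE blockK.
have := X2 (block g i); rewrite !ffunE blockK => /(monomial_inj (entry_dual g _)) ->.
by [].
Qed.

Hypothesis two_neq0 : (2 : F) != 0.

Lemma realize_star g i (x y : C) :
  monomial (entry g i) (star x y) =
    if reverses g then star (monomial (entry g (i + 1)) y) (monomial (entry g (i + 2)) x)
    else star (monomial (entry g (i + 1)) x) (monomial (entry g (i + 2)) y).
Proof.
rewrite monomial_star !star_monomial; have := entry_triple g i.
case: (reverses g) => triple; last by do 2!apply: eq_bigr => ? _; rewrite triple.
rewrite exchange_big; apply: eq_bigr => c _; apply: eq_bigr => b _.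
by rewrite triple mulrC.
Qed.

Lemma realizeM g X Y : realize g (amul X Y) = amul (realize g X) (realize g Y).
Proof.
rewrite !amulE //; congr (_, _); apply/ffunP => i; rewrite !ffunE /=.
  rewrite !(monomial_polar (entry_dual _ _)).
  by case: (reverses g) (unblockD g i) => -[-> ->]; rewrite // [X in _ + _ * X = _]addrC.
rewrite linearZ /=; congr (_ *: _); rewrite !linearD /= !linearZ /= !realize_star.
by case: (reverses g) (unblockD g i) => -[-> ->] //;
 rewrite [star _ _ + _]addrC [X.1 (_ + 2) + _]addrC [Y.1 (_ + 2) + _]addrC.
Qed.

Lemma iota_baseZ a (b : cayley_index) i : iota_ i (a *: cbase F b) = a *: iota_ i (cbase F b).
Proof.
congr (_, _); first by rewrite scaler0.
by apply/ffunP => j; rewrite !ffunE; case: ifP; rewrite ?scaler0 // !scalerA mulrC.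
Qed.

Lemma realize_base g x : exists s : bool,
  realize g (albert_base F x) = (-1) ^+ s *: albert_base F (relabel g x).
Proof.
case: x => [i|[i b]] /=.
  exists false; rewrite scale1r; congr (_, _); apply/ffunP => j; rewrite !ffunE ?linear0 //.
  by rewrite (can2_eq (unblockK g) (blockK g)).
exists (entry g (block g i) b).1; rewrite -iota_baseZ.
congr (_, _); apply/ffunP => j; rewrite !ffunE //= (can2_eq (unblockK g) (blockK g)).
by case: eqP => [->|_]; rewrite ?linear0 // linearZ /= monomial_base.
Qed.

Lemma realize_line g x :
  (linfun (realize g) @: <[albert_base F x]>)%VS = <[albert_base F (relabel g x)]>%VS.
Proof.
have [s sE] := realize_base g x.
rewrite limg_line lfunE /= sE; apply/eqP; rewrite eqEsubv.
have sub (a : F) (u : A) : (<[a *: u]> <= <[u]>)%VS by rewrite -memvE memvZ ?memv_line.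
rewrite sub /=; have := sub ((-1) ^+ s) ((-1) ^+ s *: albert_base F (relabel g x)).
by rewrite scalerA -expr2 sqrr_sign scale1r.
Qed.

Lemma realize_aut g : alg_aut (@amul F) (linfun (realize g)).
Proof.
split=> [|X Y]; last by rewrite !lfunE /= realizeM.
apply/lker0P => X Y; rewrite !lfunE /= => eqXY.
by apply/eqP; rewrite -subr_eq0; apply/eqP/(@realize_inj g); rewrite linearB /= eqXY subrr.
Qed.

End Realization.

(** * The Cartan grading and its roots *)

Lemma albert_degE x : albert_deg x = if x is inr k then row4 (deg4 k) else 0.
Proof. by case: x => [//|[i b]]; apply: iota_deg_row4. Qed.

Section Grading.
Variable F : fieldType.
Hypothesis two_neq0 : (2 : F) != 0.
Local Notation C := (cayley F).
Local Notation A := (albert F).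
Local Notation Gam := (cartan_grading F).

Lemma iota_neq0 i (c : C) : c != 0 -> iota_ i c != 0.
Proof.
apply: contraNneq => -[/ffunP/(_ i)]; rewrite !ffunE eqxx => /eqP.
by rewrite scaler_eq0 (negPf two_neq0).
Qed.

Lemma albert_base_neq0 x : albert_base F x != 0.
Proof.
case: x => [i|[i b]] /=.
  apply: contra_neq (oner_neq0 F) => -[/ffunP/(_ i)]; rewrite !ffunE eqxx //.
apply: iota_neq0; apply: contra_neq (oner_neq0 F) => /ffunP/(_ b).
by rewrite !ffunE eqxx.
Qed.

Lemma line_sub x : (<[albert_base F x]> <= Gam (albert_deg x))%VS.
Proof. by rewrite /cartan_grading (bigD1 x) //= addvSl. Qed.

Lemma suppP g : supp Gam g <-> exists x, albert_deg x = g.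
Proof.
split=> [|[x <-]]; last first.
  apply: contra_neq (albert_base_neq0 x) => Gam0; apply/eqP.
  by rewrite -memv0 -Gam0; apply/line_sub.
rewrite /supp /=; case: (pickP (fun x => albert_deg x == g)) => [x /eqP|no_x]; first by exists x.
by rewrite /cartan_grading big_pred0 // eqxx.
Qed.

(** The coordinates of a homogeneous element vanish outside its degree, since
    this holds for the basis vectors that span the component. *)
Lemma iota_homogeneous X g i b : X \in Gam g -> X.2 i b != 0 -> iota_deg i b = g.
Proof.
case/memv_sumP=> v vE ->; apply: contra_neq_eq => neq.
apply: (big_ind (fun X : A => X.2 i b = 0)) => [|Y Z Y0 Z0|k degk].
- by rewrite !ffunE.
- by rewrite !ffunE Y0 Z0 addr0.
have /vlineP[a ->] := vE k degk.
case: k degk => [j|[j c]] /= degk; rewrite !ffunE ?scaler0 //.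
case: eqP => [eq_ij|_]; last by rewrite ffunE scaler0.
have /negPf neq_bc : b != c by apply: contraNneq neq => ->; rewrite eq_ij.
by rewrite !ffunE neq_bc !scaler0.
Qed.

Lemma supp_iota1P g : supp_iota1 F g <-> exists b, iota_deg 0 b = g.
Proof.
split=> [[c c0 cg]|[b <-]]; last first.
  exists (cbase F b); first exact: (albert_base_neq0 (inr (0, b))).
  by have := line_sub (inr (0, b)); rewrite -memvE.
case: (pickP (fun b => c b != 0)) => [b cb|c_eq0].
  exists b; apply: iota_homogeneous cg _; by rewrite !ffunE; apply: mulf_neq0.
case/negP: c0; rewrite (_ : c = 0); last first.
  by apply/ffunP => b; rewrite [RHS]ffunE; apply/eqP/negbFE/c_eq0.
by apply/eqP; congr (_, _); apply/ffunP => j; rewrite !ffunE scaler0 if_same.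
Qed.

Variable R : realType.

Fact lattice_incl_is_additive : zmod_morphism (lattice_incl R).
Proof. exact: map_mxB. Qed.
HB.instance Definition _ := GRing.isZmodMorphism.Build 'rV[int]_4 'rV[R]_4
  (lattice_incl R) lattice_incl_is_additive.

Lemma lattice_incl_inj : injective (lattice_incl R).
Proof.
move=> x y /rowP eqxy; apply/rowP => i.
by have /intr_inj := etrans (esym (mxE _ _ _ _)) (etrans (eqxy i) (mxE _ _ _ _)).
Qed.

Definition embed (z : Z4) : 'rV[R]_4 := lattice_incl R (row4 z).

Fact embed_is_additive : zmod_morphism embed.
Proof. by move=> x y; rewrite /embed !raddfB. Qed.
HB.instance Definition _ := GRing.isZmodMorphism.Build Z4 'rV[R]_4 embed embed_is_additive.

Lemma embed_inj : injective embed.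
Proof. by move=> x y /lattice_incl_inj/row4_inj. Qed.

Lemma PhiP v : Phi F R v <-> exists2 z, z \in all_roots & v = embed z.
Proof.
split=> [[[g g_in <-] g_neq0]|[z zphi ->]].
  case: g_in g_neq0 => [/suppP[[i|k] <-]|[al [be]]].
  - by case; rewrite /= raddf0.
  - exists (deg4 k); last by rewrite albert_degE.
    by rewrite mem_cat; apply/orP; left; apply/short_rootsP; exists k.
  case=> /supp_iota1P[b <-] /supp_iota1P[c <-]; rewrite !iota_deg_row4.
  move=> neq neqN -> _; exists (deg4 (0, b) + deg4 (0, c)); last by rewrite /embed !raddfD.
  rewrite mem_cat; apply/orP; right.
  apply/mapP; exists (deg4 (0, b), deg4 (0, c)) => //; rewrite mem_filter.
  apply/andP; split; last first.
    by apply: allpairs_f; apply/mapP; [exists b | exists c]; rewrite // mem_cayley_list.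
  apply/andP; split; apply/eqP => /= eqd; first by case: neq; rewrite eqd.
  by case: neqN; rewrite -raddfN -eqd.
have z0 : embed z <> 0 by rewrite -(raddf0 embed) => /embed_inj/eqP; apply/negP/roots_neq0.
split=> //; exists (row4 z) => //; move: zphi; rewrite mem_cat.
case/orP=> [/short_rootsP[k ->]|/long_rootsP[b [c [-> /eqP[]]]]].
  by left; apply/suppP; exists (inr k); rewrite albert_degE.
move=> addN _ subN _; right; exists (row4 (deg4 (0, b))), (row4 (deg4 (0, c))); split.
- by apply/supp_iota1P; exists b; rewrite iota_deg_row4.
- by apply/supp_iota1P; exists c; rewrite iota_deg_row4.
- by move=> /row4_inj eqd; rewrite eqd subrr eqxx in subN.
- by rewrite -raddfN => /row4_inj eqd; rewrite eqd addNr eqxx in addN.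
- exact: raddfD.
Qed.

End Grading.

(** * The Weyl group *)

Section Main.
Variable F : fieldType.
Hypothesis two_neq0 : (2 : F) != 0.
Variable R : realType.
Local Notation A := (albert F).
Local Notation Gam := (cartan_grading F).
Local Notation embed := (@embed R).
Implicit Types (mu : 'End('rV[R]_4)) (p : short -> short) (w : seq symmetry).

Definition induces mu p := forall k, mu (embed (deg4 k)) = embed (deg4 (p k)).

Lemma GL_embed_inj mu : GL mu -> injective (mu \o embed).
Proof. by move=> /lker0P inj_mu x y /inj_mu/embed_inj. Qed.

Lemma isometric_of_induces mu p : GL mu -> induces mu p -> isometric p.
Proof.
move=> /GL_embed_inj inj_mu mu_p.
exact: (@isometric_of_additive _ (mu \o embed) embed p inj_mu (@embed_inj R) mu_p).
Qed.

(** The inclusion of mu(Phi) in Phi applies to the inverse permutation as well,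
    which gives the equality. *)
Lemma aut_of_induces mu p : GL mu -> induces mu p -> aut_Phi F R mu.
Proof.
move=> GLmu mu_p; split=> //; have iso_p := isometric_of_induces GLmu mu_p.
have [q qK pK] := injF_bij (isometric_inj iso_p).
have iso_q : isometric q by move=> k l; rewrite -iso_p !pK.
apply/seteqP; split=> [_ [v /(PhiP two_neq0)[z zphi ->] <-]|v /(PhiP two_neq0)[z zphi ->]].
  have [z' z'phi hz] := @isometric_roots _ (mu \o embed) embed p iso_p mu_p z zphi.
  by apply/(PhiP two_neq0); exists z'.
have mu_q k : embed (deg4 k) = (mu \o embed) (deg4 (q k)) by rewrite /= mu_p pK.
have [z' z'phi ->] := @isometric_roots _ embed (mu \o embed) q iso_q mu_q z zphi.
by exists (embed z') => //; apply/(PhiP two_neq0); exists z'.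
Qed.

(** A linear map that permutes Phi preserves root strings, hence short roots. *)
Lemma induces_of_aut mu : aut_Phi F R mu -> exists p, induces mu p.
Proof.
move=> [GLmu mu_Phi].
have muP z : z \in all_roots -> exists2 z', z' \in all_roots & mu (embed z) = embed z'.
  move=> zphi; apply/(PhiP two_neq0); rewrite -mu_Phi; exists (embed z) => //.
  by apply/(PhiP two_neq0); exists z.
suff /fin_all_exists[p pE] k : exists l, mu (embed (deg4 k)) = embed (deg4 l) by exists p.
have k_phi := mem_deg4_roots k; have [z z_phi muk] := muP _ k_phi.
suff /short_rootsP[l def_z] : z \in short_roots by exists l; rewrite muk def_z.
have: deg4 k \in short_roots by apply/short_rootsP; exists k.
rewrite !short_rootE // => /hasP[x xphi /andP[xk xkk]].
have [[x' x'phi mux] [y yphi muy] [t tphi mut]] := And3 (muP _ xphi) (muP _ xk) (muP _ xkk).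
have def_y : y = x' + z.
  by apply: (@embed_inj R); rewrite -muy !raddfD /= -mux -muk.
have def_t : t = x' + z + z.
  by apply: (@embed_inj R); rewrite -mut !raddfD /= -mux -muk.
by apply/hasP; exists x'; rewrite // -def_y yphi def_y -def_t tphi.
Qed.

Definition realize_word w : 'End(A) := foldr (fun g f => linfun (realize g) \o f)%VF \1%VF w.

Lemma realize_word_aut w : alg_aut (@amul F) (realize_word w).
Proof.
elim: w => [|g w [/lker0P inj_f IHw]] /=.
  by split=> [|X Y]; [apply/lker0P => X Y; rewrite !lfunE | rewrite !lfunE].
have [/lker0P inj_g gM] := realize_aut two_neq0 g.
split=> [|X Y]; last by rewrite !comp_lfunE IHw gM.
by apply/lker0P => X Y; rewrite !comp_lfunE => /inj_g/inj_f.
Qed.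

Lemma realize_word_line w x :
  (realize_word w @: <[albert_base F x]>)%VS = <[albert_base F (foldr relabel x w)]>%VS.
Proof.
elim: w => [|g w IHw] /=; first by rewrite lim1g.
by rewrite limg_comp IHw realize_line.
Qed.

(** Each component is spanned by the basis vectors of its degree. This covers
    also the component of degree 0, spanned by the three idempotents. *)
Lemma realize_word_grading w (u : {additive 'rV[int]_4 -> 'rV[int]_4}) :
  injective u ->
  (forall k, u (row4 (deg4 k)) = row4 (deg4 (act_word w k))) ->
  forall g, (realize_word w @: Gam g)%VS = Gam (u g).
Proof.
move=> inj_u u_w g; rewrite /cartan_grading limg_sum.
have relabel_bij : bijective (fun x => foldr relabel x w).
  by apply: injF_bij; elim: w {u_w} => [|g' w IHw] x y //= /relabel_inj/IHw.
rewrite [RHS](reindex _ (onW_bij _ relabel_bij)).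
apply: eq_big => [x|x _]; last exact: realize_word_line.
rewrite -(inj_eq inj_u) !albert_degE; congr (_ == _); case: x => [i|k].
  by rewrite raddf0 relabel_inl.
by rewrite u_w relabel_inr.
Qed.

(** The components of nonzero degree in the support are those of the short
    roots, so an automorphism of the grading permutes the short roots. *)
Lemma induces_of_weyl mu : weyl_GL F R mu -> exists p, induces mu p.
Proof.
case=> GLmu [C [f aut_f ->] [u [bij_u u_f] mu_u]].
(* The identity stabilizes the grading, so f itself lies in its coset. *)
have fGam s : supp Gam s -> (f @: Gam s)%VS = Gam (u s).
  apply: u_f; exists \1%VF; last by rewrite comp_lfun1r.
  have id1 : alg_aut (@amul F) \1%VF := realize_word_aut [::].
  split; last by move=> g; rewrite lim1g.
  by split=> //; apply: eq_imagel => g _; rewrite lim1g.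
suff /fin_all_exists[p pE] k : exists l, u (row4 (deg4 k)) = row4 (deg4 l).
  by exists p => k; rewrite /embed mu_u pE.
have supp_k : supp Gam (row4 (deg4 k)).
  by apply/(suppP two_neq0); exists (inr k); rewrite albert_degE.
have: supp Gam (u (row4 (deg4 k))).
  have [[/eqP ker_f _] _] := aut_f.
  by rewrite /supp /= -fGam // -lkerE ker_f subv0.
case/(suppP two_neq0) => -[i|l]; rewrite albert_degE; last by exists l.
move=> u0; have /roots_neq0/eqP[] : deg4 k \in all_roots by apply: mem_deg4_roots.
by apply: row4_inj; apply: (bij_inj bij_u); rewrite -u0 !raddf0.
Qed.

(** [induced_word] inverts a permutation by a word. Applied to the inverse of
    [p], it writes [p] as a word, whose realization is the automorphism. *)
Lemma weyl_of_induces mu p : GL mu -> induces mu p -> weyl_GL F R mu.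
Proof.
move=> GLmu mu_p; have iso_p := isometric_of_induces GLmu mu_p.
(* The restriction of mu to the lattice. *)
pose e : {additive Z4 -> Z4} := ext (deg4 \o p).
have mu_e z : mu (embed z) = embed (e z).
  rewrite [LHS](additive_ext (mu \o embed)) [RHS](raddf_scale4 embed).
  by rewrite /ext /= !mu_p.
have ep k : e (deg4 k) = deg4 (p k) by apply: (@embed_inj R); rewrite -mu_e mu_p.
have inj_e : injective e.
  by move=> x y eqe; apply: (GL_embed_inj GLmu); rewrite /= !mu_e eqe.
have [q pK qK] := injF_bij (isometric_inj iso_p).
pose e' : {additive Z4 -> Z4} := ext (deg4 \o q).
have e'K : cancel e' e.
  move=> z; rewrite [LHS](raddf_scale4 e) -[RHS]ext_deg4 /ext /= !ep.
  by rewrite !qK.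
have eK : cancel e e' by move=> z; apply: inj_e; rewrite e'K.
have ind_q : induced q by exists e' => k; apply: inj_e; rewrite ep qK e'K.
have iso_q : isometric q by move=> k l; rewrite -iso_p !qK.
have [w wq] := induced_word ind_q iso_q.
have wE k : act_word w k = p k by rewrite -[k in LHS]pK; apply: wq.
have [u [bij_u u_deg mu_u]] : exists u : {additive 'rV[int]_4 -> 'rV[int]_4},
    [/\ bijective u, forall k, u (row4 (deg4 k)) = row4 (deg4 (p k)) &
        forall z, mu (lattice_incl R z) = lattice_incl R (u z)].
  exists (row4 \o e \o unrow4 : {additive _ -> _}); split=> [|k|z] /=.
  - by exists (row4 \o e' \o unrow4) => z; rewrite /= row4K ?eK ?e'K unrow4K.
  - by rewrite row4K ep.
  - by rewrite -{1}[z]unrow4K; apply: mu_e.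
have f_u g : (realize_word w @: Gam g)%VS = Gam (u g).
  by apply: realize_word_grading (bij_inj bij_u) _ _ => k; rewrite wE.
split=> //; exists [set (realize_word w \o h)%VF | h in grading_stab (@amul F) Gam]%classic.
  exists (realize_word w) => //; split; first exact: realize_word_aut.
  have [v uK vK] := bij_u.
  have supp_u s : supp Gam (u s) <-> supp Gam s.
    have [/eqP ker_f _] := realize_word_aut w.
    by rewrite /supp /= -f_u -lkerE ker_f subv0.
  apply/seteqP; split=> _ [s supp_s <-].
    by exists (u s); [apply: (supp_u s).2 | rewrite f_u].
  by exists (v s); [apply: (supp_u (v s)).1; rewrite vK | rewrite f_u vK].
by exists u => //; split=> // _ [h [_ stab_h] <-] s _; rewrite limg_comp stab_h f_u.
Qed.

End Main.

Theorem theorem4p2 (F : closedFieldType) (R : realType)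
    (char_neq2 : 2%N \notin [pchar F]) :
  weyl_GL F R = aut_Phi F R.
Proof.
have two_neq0 : (2 : F) != 0 by move: char_neq2; rewrite inE.
apply/seteqP; split=> mu.
  move=> mu_W; have [p mu_p] := induces_of_weyl two_neq0 mu_W.
  by apply: (aut_of_induces two_neq0) mu_p; case: mu_W.
move=> mu_Phi; have [p mu_p] := induces_of_aut two_neq0 mu_Phi.
by apply: (weyl_of_induces two_neq0) mu_p; case: mu_Phi.
Qed.
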